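(* Let $\alpha$ be an infinite ordinal, and equip the ordinal intervals $[0,\alpha]$ and $[0,\alpha)$ with the order topology. Then $$\mathsf{C}(C_p([0,\alpha]))=\{\lambda : \lambda \text{ is an infinite cardinal and } \mathrm{cf}(\lambda)>|\alpha|\}=\mathsf{C}(C_p([0,\alpha))).$$
   Context: For a Tychonoff space $X$, $C_p(X)$ is the set of continuous functions $X\to\mathbb{R}$ with the topology of pointwise convergence (the subspace topology from $\mathbb{R}^X$). An infinite cardinal $\kappa$ is a caliber for a space $Z$ if for every set $I$ with $|I|=\kappa$ and every indexed family $\{U_\alpha:\alpha\in I\}$ of nonempty open subsets of $Z$ there is $J\subseteq I$ with $|J|=\kappa$ and $\bigcap_{\alpha\in J}U_\alpha\neq\emptyset$. $\mathsf{C}(Z)$ denotes the class of all infinite cardinals that are calibers for $Z$. *)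

(* Defs.v *)
From HB Require Import structures.
From mathcomp Require Import all_boot all_order all_algebra.
From mathcomp Require Import all_classical all_reals all_analysis.
From mathcomp Require Import wochoice.

Set Implicit Arguments.
Unset Strict Implicit.
Unset Printing Implicit Defensive.

Import Order.TTheory.
Import numFieldNormedType.Exports.

Local Open Scope classical_set_scope.
Local Open Scope order_scope.
Local Open Scope card_scope.

Definition card_lt (T U : Type) (A : set T) (B : set U) : Prop :=
  A #<= B /\ A #!= B.

(* As a set, an ordinal a of a well-ordered type W is [set x : W | x < a]. A
   cardinal is represented by its initial ordinal, up to order isomorphism: a
   well-ordered type all of whose proper initial segments are strictly
   smaller in cardinality. *)
Definition well_ordered (d : Order.disp_t) (T : orderType d) : Prop :=
  well_order (<=%O : rel T).

Definition infinite_cardinal (d : Order.disp_t) (K : orderType d) : Prop :=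
  [/\ well_ordered K, infinite_set [set: K] &
      forall k : K, card_lt [set x : K | x < k] [set: K]].

Definition cofinal (d : Order.disp_t) (K : orderType d) (A : set K) : Prop :=
  forall k : K, exists2 x, A x & k <= x.

Definition initial_segment (d : Order.disp_t) (K : orderType d) (S : set K) :
  Prop := forall x y : K, x <= y -> S y -> S x.

(* cf(K) is the least ordinal that maps onto a cofinal subset of K. It is at
   most K, hence is an initial segment of K; and the least element of a family
   of initial segments is its intersection. *)
Definition cofinality (d : Order.disp_t) (K : orderType d) : set K :=
  \bigcap_(S in [set S : set K |
      initial_segment S /\ exists f : K -> K, cofinal (f @` S)]) S.
Arguments cofinality {d} K.

Lemma cofinality_attained (d : Order.disp_t) (K : orderType d) :
  well_ordered K ->
  initial_segment (cofinality K) /\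
  exists f : K -> K, cofinal (f @` cofinality K).
Proof.
move=> wo; split=> [x y xy cy S SP|]; first exact: (SP.1 _ _ xy (cy S SP)).
pose P (S : set K) := initial_segment S /\ exists f : K -> K, cofinal (f @` S).
have [[x0 Px0]|noP] := pselect (exists x : K, P [set y | y < x]); last first.
  have -> : cofinality K = setT.
    apply/seteqP; split=> // x _ S [Si Sf]; apply: contrapT => nSx.
    apply: noP; exists x; split=> [y z yz /= zx|]; first exact: le_lt_trans zx.
    case: Sf => f fS; exists f => k; have [_ [y Sy <-] ky] := fS k.
    exists (f y) => //; exists y => //=; rewrite ltNge; apply/negP => xy.
    exact: nSx (Si _ _ xy Sy).
  by exists id => k; exists k => //; exists k.
have [|m [[mP mmin] _]] := wo (fun x => `[< P [set y | y < x] >]).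
  by exists x0; apply/asboolP.
have /asboolP Pm : `[< P [set y | y < m] >] by exact: mP.
suff -> : cofinality K = [set y | y < m] by case: Pm.
apply/seteqP; split=> [y cy|y /= ym S [Si [f fS]]]; first exact: cy _ Pm.
apply: contrapT => nSy.
suff : m <= y by rewrite leNgt ym.
apply: mmin; apply/asboolP; split=> [u v uv /= vy|]; first exact: le_lt_trans vy.
exists f => k; have [_ [z Sz <-] kz] := fS k.
exists (f z) => //; exists z => //=; rewrite ltNge; apply/negP => yz.
exact: nSy (Si _ _ yz Sz).
Qed.

Definition caliber (d : Order.disp_t) (K : orderType d) (Z : topologicalType) :
    Prop :=
  forall (I : Type) (U : I -> set Z), [set: I] #= [set: K] ->
    (forall i, open (U i) /\ U i !=set0) ->
    exists J : set I, J #= [set: K] /\ \bigcap_(i in J) U i !=set0.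

(* This also forces the universe of the index types I in caliber to be at
   least that of K. *)
Lemma caliberE (d : Order.disp_t) (K : orderType d) (Z : topologicalType) :
  caliber K Z <->
  forall U : K -> set Z, (forall i, open (U i) /\ U i !=set0) ->
    exists J : set K, J #= [set: K] /\ \bigcap_(i in J) U i !=set0.
Proof.
split=> [cK U Uo|cK I U IK Uo]; first exact: (cK K U (card_eqxx _) Uo).
have /card_eqP[f] := card_esym IK.
pose g k := val (f (to_setT k)).
have inT (A : Type) (z : A) : z \in [set: A] by rewrite inE.
have ginj : injective g.
  by move=> x y /val_inj /(inj (inT _ _) (inT _ _)) /(congr1 val).
have [k|J [JK [z Jz]]] := cK (U \o g); first exact: Uo.
exists (g @` J); split; last by exists z => _ [k Jk <-]; exact: Jz.
by apply: card_eq_trans JK; apply: inj_card_eq; apply: in2W.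
Qed.

Definition Cp (X : topologicalType) (R : realType) : topologicalType :=
  initial_topology (fun f : continuousType X R => (f : {ptws X -> R})).

(* The topology is generated by the order of A itself, which for general A can
   be coarser than the subspace topology. *)
Definition ord_interval (d : Order.disp_t) (W : orderType d) (A : set W) :
  topologicalType := order_topology (sub_type A).

(* Main.v *)
Require Import Defs.
From mathcomp Require Import all_boot all_order all_algebra.
From mathcomp Require Import finmap.
From mathcomp Require Import all_classical all_reals all_analysis.
From mathcomp Require Import wochoice lra.
From Stdlib Require Import Relation_Operators Wellfounded.

(** Write X for either interval, L for the cardinal, cf for its cofinality. The
    order topology of a well-order X is all that matters, and both intervals
    have the same cardinality as alpha.

    If |X| < cf, then L is a caliber. Finite lists of conditions p < f(x) < q
    with rational p, q give a base of Cp X, so each of the L many given open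
    sets contains a nonempty basic set. Since |X| < cf, a colouring of L by
    such lists is constant on a set of full cardinality: this is a pigeonhole
    principle for fewer than cf colours ([full_fibres_lt_cofinality]), applied
    entry by entry to lists of points and rationals ([full_fibres_seq]). All
    the open sets indexed by that colour class contain one common basic set.
    The pigeonhole principle for a possibly singular L rests on k * k = k for
    infinite k ([square_card_le]): if all fibres were small, their sizes would
    have a common bound k < L, because there are fewer than cf of them.

    If cf <= |X|, then L is not a caliber, because Cp X has a point-finite
    family of |X| many nonempty open sets ([point_finite_family]). Its b-th
    member asks f to jump by more than 1/2 between b and the successor of b.
    If f jumped so at infinitely many b, take the least c below which there
    are infinitely many such b: jumps occur arbitrarily close to c, so f is
    discontinuous at c ([finite_jumps]). This needs c in X, and jumps could
    still be cofinal in X without a last point; then their order type is omega,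
    and prescribing the value of f at the least point of X up to 1/2 as a
    suitable integer depending on b removes this possibility ([count_ex]).
    Distributing L over cf many members of the family along a cofinal map, any
    set of indices with a common point is bounded in L, hence too small. *)

Set Implicit Arguments.
Unset Strict Implicit.
Unset Printing Implicit Defensive.

Import Order.TTheory GRing.Theory Num.Theory.
Import numFieldNormedType.Exports.

Local Open Scope order_scope.
Local Open Scope classical_set_scope.
Local Open Scope card_scope.

(** * Comparing cardinalities *)

Lemma card_le_inj (T U : Type) (A : set T) (B : set U) (f : T -> U) :
  set_fun A B f -> set_inj A f -> A #<= B.
Proof.
by move=> fAB fI; have /injfunPex[g] : exists2 f : T -> U, set_fun A B f &
  set_inj A f by [exists f]; exact: inj_card_le.
Qed.

Lemma card_leE (T U : Type) (A : set T) (B : set U) (u0 : U) :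
  A #<= B -> exists2 f : T -> U, set_fun A B f & set_inj A f.
Proof.
elim/Ppointed: U => U in B u0 *; first by case: (no u0).
by move=> /pcard_leP/injfunPex.
Qed.

Lemma card_le_surj (T U : Type) (A : set T) (B : set U) (f : T -> U) :
  B `<=` f @` A -> B #<= A.
Proof.
by move=> /subset_card_le/card_le_trans; apply; exact: card_image_le.
Qed.

Lemma card_le_setX (T U T' U' : Type) (A : set T) (B : set U) (A' : set T')
    (B' : set U') : A #<= A' -> B #<= B' -> A `*` B #<= A' `*` B'.
Proof.
elim/Ppointed: T' => T' in A' *.
  by rewrite emptyE => /eqP ->; rewrite set0X.
elim/Ppointed: U' => U' in B' *.
  by move=> _; rewrite emptyE => /eqP ->; rewrite setX0.
move=> /(card_leE point)[f fA finj] /(card_leE point)[g gB ginj].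
apply: (@card_le_inj _ _ _ _ (fun x => (f x.1, g x.2))).
  by move=> [x y] [/= /fA ? /gB].
move=> [x y] [x' y']; rewrite !inE => -[/= Ax By] [/= Ax' By'] [fxx' gyy'].
by congr pair; [apply: finj|apply: ginj]; rewrite ?inE.
Qed.

Lemma card_le_antisym (T U : Type) (A : set T) (B : set U) :
  A #<= B -> B #<= A -> A #= B.
Proof. by move=> AB BA; rewrite card_eq_le AB BA. Qed.

Lemma card_le_lt_trans (T U V : Type) (A : set T) (B : set U) (C : set V) :
  A #<= B -> card_lt B C -> card_lt A C.
Proof.
move=> AB [BC BNC]; split; first exact: card_le_trans BC.
apply: contra BNC => AC; apply: (card_le_antisym BC).
by apply: card_le_trans AB; move: AC; rewrite card_eq_le => /andP[].
Qed.

Lemma card_ltNge (T U : Type) (A : set T) (B : set U) :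
  card_lt A B -> ~ (B #<= A).
Proof. by move=> [AB /negP ANB] BA; apply: ANB; exact: card_le_antisym. Qed.

(** Hilbert's hotel: along a sequence e in A, send [e 0] to the new point and
    [e n.+1] to [e n]. *)
Lemma infinite_card_setU1 (T : Type) (A : set T) (x : T) :
  infinite_set A -> A `|` [set x] #<= A.
Proof.
move=> /infiniteP/(card_leE x)[e eA einj].
have {}einj m n : e m = e n -> m = n by apply: einj; rewrite inE.
pose g z := if pselect (exists n, z = e n) is left zn then
  (if projT1 (cid zn) is k.+1 then e k else x) else z.
have ge n : g (e n) = if n is k.+1 then e k else x.
  rewrite /g; case: pselect => [ex|[]]; last by exists n.
  by case: cid => /= m /einj <-.
apply: (@card_le_surj _ _ _ _ g) => z [Az|->].
  have [[n ->]|zNe] := pselect (exists n, z = e n).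
    by exists (e n.+1); [exact: eA|exact: ge].
  by exists z => //; rewrite /g; case: pselect.
by exists (e 0%N); [exact: eA|exact: ge].
Qed.

Lemma wo_min (d : Order.disp_t) (K : orderType d) (P : set K) :
  well_ordered K -> P !=set0 -> exists2 m, P m & forall x, P x -> m <= x.
Proof.
move=> wo [x0 Px0]; have [|m [[mP mmin] _]] := wo (fun x => `[< P x >]).
  by exists x0; apply/asboolP.
by exists m => [|x Px]; [exact/asboolP|apply: mmin; exact/asboolP].
Qed.

Lemma wo_wf (d : Order.disp_t) (K : orderType d) :
  well_ordered K -> well_founded (fun x y : K => x < y).
Proof.
move=> wo x; apply: contrapT => xNacc.
have [|m mNacc mmin] :=
  wo_min (P := [set y | ~ Acc (fun x y : K => x < y) y]) wo.
  by exists x.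
apply: mNacc; constructor => y ym; apply: contrapT => /mmin.
by rewrite leNgt ym.
Qed.

(** Transfinite recursion along r sends each x in D to a point of A not used
    before x. Either fresh points never run out, which embeds D into A, or they
    run out at some x, and then A is covered by the images of the predecessors
    of x. Besides comparability of cardinalities, this shows that a set too
    small to contain a copy of D fits below some point of D. *)
Lemma wf_compare (T U : Type) (r : T -> T -> Prop) (D : set T) (A : set U) :
  well_founded r -> (forall x y, x <> y -> r x y \/ r y x) ->
  D #<= A \/ exists2 x, D x & A #<= D `&` [set y | r y x].
Proof.
move=> rwf rtot.
have [[a0 Aa0]|/nonemptyPn ->] := pselect (A !=set0); last first.
  have [[x Dx]|/nonemptyPn ->] := pselect (D !=set0); last by left.
  by right; exists x.
pose pick (P : set U) := if pselect (exists a, P a) is left e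
  then projT1 (cid e) else a0.
have pickP P : (exists a, P a) -> P (pick P).
  by rewrite /pick; case: pselect => // e _; case: cid.
pose F x (rec : forall y, r y x -> U) :=
  pick [set a | A a /\ forall y (p : r y x), D y -> rec y p <> a].
pose h := Fix rwf (fun=> U) F.
have hE x : h x = pick [set a | A a /\ forall y, r y x -> D y -> h y <> a].
  rewrite /h Fix_eq // => {}x f g fg; rewrite /F; congr pick.
  by apply/funext => a; apply/propext; split=> -[Aa N]; split=> // y p;
    move: (N y p); rewrite fg.
have [[x [Dx xN]]|N] := pselect (exists x, D x /\
    ~ exists a, A a /\ forall y, r y x -> D y -> h y <> a).
  right; exists x => //; apply: (@card_le_surj _ _ _ _ h) => a Aa.
  apply: contrapT => aN; apply: xN; exists a; split=> // y yx Dy ya.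
  by apply: aN; exists y.
have hP x : D x -> A (h x) /\ forall y, r y x -> D y -> h y <> h x.
  move=> Dx; rewrite [h x]hE.
  apply: (pickP [set a | A a /\ forall y, r y x -> D y -> h y <> a]).
  by apply: contrapT => xN; apply: N; exists x.
left; apply: (@card_le_inj _ _ _ _ h) => [x /hP[]//|x y].
rewrite !inE => Dx Dy hxy; apply: contrapT => /rtot[] xy.
  by have [_ /(_ x xy Dx)] := hP _ Dy.
by have [_ /(_ y xy Dy)] := hP _ Dx; rewrite hxy.
Qed.

Lemma lt_compare (d : Order.disp_t) (K : orderType d) (U : Type) (D : set K)
    (A : set U) : well_ordered K ->
  D #<= A \/ exists2 x, D x & A #<= D `&` [set y | y < x].
Proof.
move=> /wo_wf/wf_compare; apply=> x y xy.
by have /orP[] := lt_total (introN eqP xy); [left|right].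
Qed.

(** Goedel's pairing order sorts pairs by their maximum first, so the
    predecessors of (a, b) lie in the square of the segment up to max(a, b). If
    the square over m did not embed into the segment below m, that segment
    would embed into the square of a shorter one, which by induction is no
    larger than the shorter segment itself. *)
Lemma square_card_le (d : Order.disp_t) (K : orderType d) (m : K) :
  well_ordered K -> infinite_set [set x | x < m] ->
  [set x | x < m] `*` [set x | x < m] #<= [set x | x < m].
Proof.
move=> wo; elim/(well_founded_ind (wo_wf wo)): m => m IH minf.
pose lt (x y : K) : Prop := x < y.
pose r (p q : K * K) := slexprod _ _ lt (slexprod _ _ lt lt)
  (Order.max p.1 p.2, p) (Order.max q.1 q.2, q).
have rwf : well_founded r.
  apply: (wf_inverse_image _ _ _ (fun p : K * K => (Order.max p.1 p.2, p))).
  by apply: wf_slexprod; [|apply: wf_slexprod]; exact: wo_wf.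
have rtot p q : p <> q -> r p q \/ r q p.
  case: p q => [a b] [a' b'] pq; rewrite /r /=.
  have [lt1|lt1|eq1] := ltgtP (Order.max a b) (Order.max a' b').
  - by left; constructor.
  - by right; constructor.
  rewrite eq1; have [lt2|lt2|eq2] := ltgtP a a'.
  - by left; do 2 constructor.
  - by right; do 2 constructor.
  rewrite -eq2 in pq *; have [lt3|lt3|eq3] := ltgtP b b'.
  - by left; do 2 constructor.
  - by right; do 2 constructor.
  by rewrite eq3 in pq.
have rmax p q : r p q -> Order.max p.1 p.2 <= Order.max q.1 q.2.
  by rewrite /r => H; inversion H => //; exact: ltW.
have [//|[[a b] [/= am bm] le]] := wf_compare
  ([set x | x < m] `*` [set x | x < m]) [set x | x < m] rwf rtot.
pose k := Order.max a b; pose Ik := [set x | x < k] `|` [set k].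
have km : k < m by rewrite gt_max am bm.
have {le}le : [set x | x < m] #<= Ik `*` Ik.
  apply: card_le_trans le _; apply: subset_card_le => -[x y] [_ /rmax /=].
  rewrite ge_max => /andP[xk yk].
  by split; [move: xk|move: yk]; rewrite /= le_eqVlt => /orP[/eqP|];
    [right|left|right|left].
have kinf : infinite_set [set x | x < k].
  move=> kfin; apply: minf; apply: card_le_finite le _; apply: finite_setX;
    by rewrite finite_setU; split=> //; exact: finite_set1.
have {le}le : [set x | x < m] #<= [set x | x < k].
  apply: card_le_trans le _; apply: card_le_trans (IH k km kinf).
  by apply: card_le_setX; exact: infinite_card_setU1.
apply: (card_le_trans (card_le_setX le le)).
apply: card_le_trans (IH k km kinf) _; apply: subset_card_le => x /= xk.
exact: lt_trans km.
Qed.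

(** * Cofinality and the pigeonhole principle *)

(** Were x unbounded on A, it would be cofinal; but A embeds below some c in the
    cofinality, so the segment below c would already map onto a cofinal set. *)
Lemma bounded_lt_cofinality (d : Order.disp_t) (L : orderType d) (T : Type)
    (A : set T) (x : T -> L) : well_ordered L ->
  card_lt A (cofinality L) -> exists m, forall a, A a -> x a < m.
Proof.
move=> wo AC; apply: contrapT => Nbnd.
have unbnd m : exists2 a, A a & m <= x a.
  apply: contrapT => Nm; apply: Nbnd; exists m => a Aa.
  by rewrite ltNge; apply/negP => mx; apply: Nm; exists a.
have [|[c Cc Ac]] := lt_compare (cofinality L) A wo; first exact: card_ltNge.
have [f fA finj] := card_leE c Ac.
pose S := [set y | y < c]; pose g y :=
  if pselect (exists a, A a /\ f a = y) is left e
  then x (projT1 (cid e)) else c.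
suff : S c by rewrite /S /= ltxx.
apply: (Cc S); split=> [y z yz /= zc|]; first exact: le_lt_trans zc.
exists g => k; have [a Aa kxa] := unbnd k; have [_ fac] := fA a Aa.
exists (g (f a)); first by exists (f a).
rewrite /g; case: pselect => [e|[]]; last by exists a.
by case: cid => /= b [Ab fba]; rewrite (finj _ _ _ _ fba) ?inE.
Qed.

Section pigeonhole.
Variables (d : Order.disp_t) (L : orderType d).
Hypothesis L_card : infinite_cardinal L.

(** The pigeonhole principle for colours in T: every colouring of L many points
    has a colour class of size L. Colouring subsets J of L, rather than only L,
    lets colourings be refined one after the other. *)
Definition full_fibres (T : Type) := forall (J : set L) (g : L -> T),
  J #= [set: L] -> exists t, J `&` g @^-1` [set t] #= [set: L].

Lemma full_nonempty (J : set L) : J #= [set: L] -> J !=set0.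
Proof.
move=> JL; apply: infinite_setN0 => Jfin; case: L_card => _ + _; apply.
by apply: card_le_finite Jfin; move: JL; rewrite card_eq_le => /andP[].
Qed.

(** If every fibre is smaller than L, it embeds below some point x of L, and
    these points have a common bound since there are fewer than cf(L) fibres.
    Then L embeds into the product of two proper segments, hence into one. *)
Lemma full_fibres_lt_cofinality (T : Type) :
  card_lt [set: T] (cofinality L) -> full_fibres T.
Proof.
have [wo Linf Llt] := L_card.
move=> TC J g JL; apply: contrapT => Nfib.
have LJ : [set: L] #<= J by move: JL; rewrite card_eq_le => /andP[].
have small t : exists x : L, J `&` g @^-1` [set t] #<= [set y : L | y < x].
  have [le|[x _ le]] := lt_compare [set: L] (J `&` g @^-1` [set t]) wo.
    by case: Nfib; exists t; apply: card_le_antisym => //; exact: card_leT.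
  by exists x; apply: card_le_trans le _; exact: subset_card_le.
have [x xP] := choice small.
have [m xm] := bounded_lt_cofinality x wo TC.
have [LT|[m' _ Tm']] := lt_compare [set: L] [set: T] wo.
  by apply: (card_ltNge TC); apply: card_le_trans LT; exact: card_leT.
pose M := Order.max m m'; pose I := [set y : L | y < M].
have TI : [set: T] #<= I.
  apply: card_le_trans Tm' _; apply: subset_card_le => y [_ /= ym'].
  by rewrite /I /= lt_max ym' orbT.
have fibI t : J `&` g @^-1` [set t] #<= I.
  apply: card_le_trans (xP t) _; apply: subset_card_le => y /= yx.
  by rewrite /I /= lt_max (lt_trans yx) ?xm.
have JI : J #<= I `*` I.
  have Jsq : J #<= [set: T] `*` I.
    have /choice[e eP] t : exists e : L -> L,
        set_fun (J `&` g @^-1` [set t]) I e /\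
        set_inj (J `&` g @^-1` [set t]) e.
      by have [e eI einj] := card_leE M (fibI t); exists e.
    apply: (@card_le_inj _ _ _ _ (fun i => (g i, e (g i) i))).
      by move=> i Ji; split=> //=; apply: (eP (g i)).1.
    move=> i j; rewrite !inE => Ji Jj [gij eij].
    by apply: (eP (g i)).2; rewrite ?inE //= {2}gij.
  exact: card_le_trans Jsq (card_le_setX TI (card_lexx _)).
have [Ifin|Iinf] := pselect (finite_set I).
  apply: Linf; apply: card_le_finite (card_le_trans LJ JI) _.
  exact: finite_setX.
apply: (card_ltNge (Llt M)); apply: card_le_trans (square_card_le wo Iinf).
exact: card_le_trans JI.
Qed.

Lemma full_fibres_prod (T U : Type) :
  full_fibres T -> full_fibres U -> full_fibres (T * U).
Proof.
move=> fT fU J g /fT-/(_ (fst \o g))[t] /fU-/(_ (snd \o g))[u] JL.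
exists (t, u).
suff -> : J `&` g @^-1` [set (t, u)] =
  J `&` (fst \o g) @^-1` [set t] `&` (snd \o g) @^-1` [set u] by [].
apply/seteqP; split=> i /=.
  by move=> [Ji ->].
by move=> [[Ji <-] <-]; rewrite -surjective_pairing.
Qed.

(** Colour first by the length of the list, then by its entries in turn. *)
Lemma full_fibres_seq (T : Type) :
  full_fibres nat -> full_fibres T -> full_fibres (seq T).
Proof.
move=> fnat fT J g JL.
have [n {}JL] := fnat J (size \o g) JL.
suff sizen n' (J' : set L) (g' : L -> seq T) :
    J' #= [set: L] -> (forall i, J' i -> size (g' i) = n') ->
    exists t, J' `&` g' @^-1` [set t] #= [set: L].
  have [|t tL] := sizen n _ g JL; first by move=> i [].
  exists t; apply: card_le_antisym; first exact: card_leT.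
  move: tL; rewrite card_eq_le => /andP[_ /card_le_trans]; apply.
  by apply: subset_card_le; apply: setSI; exact: subIsetl.
elim: n' => [|k IH] in J' g' *.
  move=> JL' g0; exists [::].
  suff -> : J' `&` g' @^-1` [set [::]] = J' by [].
  by apply/seteqP; split=> i; [case|move=> Ji; split=> //; exact/size0nil/g0].
move=> JL' gS; have [i0 /gS] := full_nonempty JL'.
case: (g' i0) => // x0 _ _.
have [x {}JL'] := fT J' (head x0 \o g') JL'.
have [i [J'i _]|s] := IH _ (behead \o g') JL'; first by rewrite size_behead gS.
move=> sL; exists (x :: s); move: sL; congr (is_true (_ #= _)).
apply/seteqP; split=> i /=.
  by move=> [[J'i <-] <-]; split=> //; move: (gS i J'i); case: (g' i).
by move=> [J'i ->].
Qed.

End pigeonhole.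

(** * Topology of the function space *)

Definition rational_box (X : Type) (R : realType)
    (s : seq (X * (rat * rat))) : set (X -> R) :=
  [set g | all (fun t => ratr t.2.1 < g t.1 < ratr t.2.2)%R s].

Lemma rational_box_cat (X : Type) (R : realType)
    (s t : seq (X * (rat * rat))) :
  rational_box (R := R) (s ++ t) = rational_box s `&` rational_box t.
Proof.
by apply/seteqP; split=> g; rewrite /rational_box /= all_cat => /andP.
Qed.

(** The sets containing a box around f form a filter; it converges to f at
    every point, hence pointwise, so every neighbourhood of f belongs to it. *)
Lemma ptws_nbhs_box (X : topologicalType) (R : realType) (f : {ptws X -> R})
    (V : set {ptws X -> R}) : nbhs f V ->
  exists2 s, rational_box s f & rational_box s `<=` V.
Proof.
pose G : set_system {ptws X -> R} :=
  filter_from [set s | rational_box s f] (fun s => rational_box s).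
have GF : Filter G.
  apply: filter_from_filter; first by exists [::].
  move=> s t sf tf; exists (s ++ t); first by rewrite /= rational_box_cat.
  by rewrite rational_box_cat.
suff Gf : {ptws, G --> f} by move=> /Gf [s sf sV]; exists s.
apply/pointwise_cvgP => x; apply/cvgrPdist_lt => e e0.
have [|p] := @rat_in_itvoo R (f x - e)%R (f x); first by lra.
rewrite in_itv /= => /andP[p1 p2].
have [|q] := @rat_in_itvoo R (f x) (f x + e)%R; first by lra.
rewrite in_itv /= => /andP[q1 q2].
exists [:: (x, (p, q))]; first by rewrite /rational_box /= p2 q1.
move=> g; rewrite /rational_box /= andbT => /andP[pg gq].
by rewrite ltr_distlC; apply/andP; split; lra.
Qed.

(** Each U i contains a nonempty rational box; L many of the boxes coincide. *)
Lemma lt_cofinality_caliber_Cp (X : topologicalType) (R : realType)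
    (dL : Order.disp_t) (L : orderType dL) :
  infinite_cardinal L -> infinite_set [set: X] ->
  card_lt [set: X] (cofinality L) -> caliber L (Cp X R).
Proof.
move=> L_card /infiniteP Xinf XL; apply/caliberE => U Uo.
have fnat : full_fibres L nat.
  apply: full_fibres_lt_cofinality => //; exact: card_le_lt_trans XL.
have frat : full_fibres L rat.
  apply: full_fibres_lt_cofinality => //; apply: card_le_lt_trans XL.
  by apply: card_le_trans Xinf; move: card_rat; rewrite card_eq_le => /andP[].
have fX : full_fibres L X by exact: full_fibres_lt_cofinality.
have /choice[h hP] i : exists h : Cp X R * seq (X * (rat * rat)),
    rational_box h.2 (h.1 : continuousType X R) /\
    forall g : continuousType X R, rational_box h.2 g -> U i g.
  have [[V oV <-] [f Vf]] := Uo i.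
  have [|s sf sV] := @ptws_nbhs_box X R (f : continuousType X R) V.
    exact: open_nbhs_nbhs.
  by exists (f, s); split=> // g /sV.
have fseq := full_fibres_seq L_card fnat
  (full_fibres_prod fX (full_fibres_prod frat frat)).
move: fseq => /(_ [set: L] (snd \o h) (card_eqxx _))[s sL].
have [i0 [_ i0s]] := full_nonempty L_card sL.
exists ([set: L] `&` (snd \o h) @^-1` [set s]); split=> //.
exists (h i0).1 => i [_ his]; apply: (hP i).2.
by move: his i0s => /= -> <-; exact: (hP i0).1.
Qed.

Lemma Cp_eval_continuous (X : topologicalType) (R : realType) (x : X) :
  continuous (fun g : Cp X R => (g : continuousType X R) x : R).
Proof.
move=> f; apply: (@continuous_comp (Cp X R) {ptws X -> R} R
  (fun f : continuousType X R => (f : {ptws X -> R})) (fun g => g x)).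
  exact: initial_continuous.
exact: (@proj_continuous X (fun=> R) x).
Qed.

Lemma open_lt_continuous (Z : topologicalType) (R : realType) (u v : Z -> R) :
  continuous u -> continuous v -> open [set z | u z < v z]%R.
Proof.
move=> cu cv; have cuv : continuous (fun z => v z - u z)%R.
  by move=> z; apply: cvgB; [exact: cv|exact: cu].
rewrite (_ : mkset _ = (fun z => v z - u z)%R @^-1` [set y : R | 0 < y]%R).
  by move/continuousP: cuv; apply; exact: open_gt.
by apply/seteqP; split=> z /=; rewrite subr_gt0.
Qed.

(** * Jumps of continuous functions on a well-ordered space *)

Section well_ordered_space.
Variables (d : Order.disp_t) (X : orderTopologicalType d) (R : realType).
Hypothesis wo : well_ordered X.

Lemma successor_ex (b : X) :
  (exists y, b < y) -> exists2 s, b < s & forall y, b < y -> s <= y.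
Proof. by move=> /(wo_min wo). Qed.

(** If b has a successor s, the closed ray up to b is the open ray below s. *)
Lemma lray_clopen (b : X) : clopen [set y | y <= b].
Proof.
split; last by have := @lray_closed _ X b; rewrite set_itvE.
have [|noy] := pselect (exists y, b < y).
  move=> /successor_ex[s bs smin].
  suff -> : [set y | y <= b] = `]-oo, s[%classic by exact: lray_open.
  apply/seteqP; split=> y /=; rewrite in_itv /=.
    by move=> yb; exact: le_lt_trans bs.
  by move=> ys; rewrite leNgt; apply/negP => /smin; rewrite leNgt ys.
suff -> : [set y | y <= b] = setT by exact: openT.
apply/seteqP; split=> // y _ /=; rewrite leNgt; apply/negP => yb.
by apply: noy; exists y.
Qed.

Lemma step_continuous (b : X) (u v : R) :
  continuous (fun y => if y <= b then u else v).
Proof.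
move=> y; have [bo bc] := lray_clopen b; have [yb|yb] := leP y b.
  apply: cvg_near_cst; near=> z; suff -> : z <= b by rewrite yb.
  by near: z; exact: open_nbhs_nbhs.
apply: cvg_near_cst; near=> z; suff /negP/negbTE -> : ~ (z <= b).
  by rewrite leNgt yb.
near: z; apply: (@open_nbhs_nbhs _ y (~` [set z | z <= b])).
by split; [exact: closed_openC|apply/negP; rewrite -ltNge].
Unshelve. all: by end_near.
Qed.

(** The inequality is quantified over all successors s of b, of which there is
    at most one, so a greatest element b always belongs to this set. *)
Definition jumps (f : X -> R) : set X := [set b | forall s : X, b < s ->
  (forall y, b < y -> s <= y) -> (f b + 2^-1 < f s)%R].

(** For the least c with infinitely many jumps below it, there are only finitely
    many jumps below any l < c, so some b < c in a given neighbourhood of c is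
    a jump. The successor of b is then at most c and lies in that neighbourhood
    too, which contradicts continuity at c. *)
Lemma finite_jumps (f : X -> R) (c : X) : continuous f ->
  finite_set (jumps f `&` [set b | b < c]).
Proof.
move=> fc; apply: contrapT => cinf.
have [|{cinf}c cinf cmin] :=
  wo_min (P := [set c | infinite_set (jumps f `&` [set b | b < c])]) wo.
  by exists c.
have /cvgrPdist_lt/(_ (4^-1)%R) := fc c; rewrite invr_gt0 ltr0n => /(_ isT).
rewrite itv_nbhsE => -[i [iopen ci] iP].
suff [b [[jb bc] bi]] : exists b, (jumps f `&` [set b | b < c]) b /\
    forall y, b <= y <= c -> y \in i.
  have [s bs smin] : exists2 s, b < s & forall y, b < y -> s <= y.
    by apply: successor_ex; exists c.
  have := jb s bs smin.
  have /= := iP b (bi b _); rewrite lexx (ltW bc) => /(_ isT).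
  have /= := iP s (bi s _); rewrite (ltW bs) smin // => /(_ isT).
  rewrite !ltr_distlC => /andP[s1 s2] /andP[b1 b2]; lra.
case: i iopen ci iP => -[[] l|[]] r //= iopen ci _.
- have lc : l < c by move: ci; rewrite itv_boundlr => /andP[].
  apply: contrapT => Nb; have lfin : finite_set (jumps f `&` [set b | b < l]).
    by apply: contrapT => /cmin; rewrite leNgt lc.
  apply: cinf.
  apply: (sub_finite_set (B := (jumps f `&` [set b | b < l]) `|` [set l])).
    move=> b [jb bc]; have [bl|lb|->] := ltgtP b l; [by left| |by right].
    exfalso; apply: Nb; exists b; split=> // y /andP[by_ yc].
    move: ci; rewrite !itv_boundlr => /andP[_ cr].
    rewrite bnd_simp (lt_le_trans lb) //=.
    by apply: le_trans cr; rewrite bnd_simp.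
  rewrite finite_setU; split=> //; exact: finite_set1.
- have [b bP] := infinite_setN0 cinf; exists b; split=> // y /andP[_ yc].
  move: ci; rewrite !itv_boundlr => /andP[_ cr] /=.
  by apply: le_trans cr; rewrite bnd_simp.
Qed.

(** A set S that is finite below every point can only be infinite if it is
    cofinal in X with order type omega. If there is one such set S0, let n(b)
    count the points of S0 below b: then each fibre of n is bounded in X, so it
    meets every other such S in a finite set. If there is none,
    every S is finite and n = 0 will do. *)
Lemma count_ex : exists n : X -> nat, forall S : set X,
  (forall c, finite_set (S `&` [set b | b < c])) ->
  forall k, finite_set (S `&` n @^-1` [set k]).
Proof.
have [[S0 [S0inf S0fin]]|noS0] := pselect (exists S0 : set X, infinite_set S0 /\
    forall c, finite_set (S0 `&` [set b | b < c])); last first.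
  exists (fun=> 0%N) => S Sfin k; apply: contrapT => Sinf.
  by apply: noS0; exists S; split=> //; apply: sub_infinite_set Sinf.
exists (fun b => #|` fset_set (S0 `&` [set a | a < b])|) => S Sfin k.
have [B BS0 kB] := infinite_set_fset k.+1 S0inf.
apply: (sub_finite_set (B := \bigcup_(c in [set` B])
    ((S `&` [set b | b < c]) `|` [set c]))); last first.
  apply: bigcup_finite => // c _; rewrite finite_setU; split=> //.
move=> b [Sb /= bk]; apply: contrapT => bN.
suff : (#|` B| <= k)%N by rewrite leqNgt kB.
rewrite -bk; apply: fsubset_leq_card; apply/fsubsetP => c cB.
rewrite in_fset_set; last exact: S0fin.
apply/mem_set; split; first exact: BS0.
rewrite /= ltNge; apply/negP => bc; apply: bN; exists c => //.
by move: bc; rewrite le_eqVlt => /orP[/eqP ->|]; [right|left].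
Qed.

(** The b-th set consists of the f that jump at b and whose value at the least
    point x0 is within 1/2 of n(b), with n from [count_ex]. A given f fixes
    n(b), hence lies in the b-th set for finitely many b only. *)
Lemma point_finite_family : [set: X] !=set0 -> exists V : X -> set (Cp X R),
  (forall b, open (V b) /\ V b !=set0) /\
  forall f, finite_set [set b | V b f].
Proof.
move=> /(wo_min wo)[x0 _ x0min]; have [n nP] := count_ex.
pose ev (f : Cp X R) : X -> R := (f : continuousType X R).
exists (fun b => [set f | ev f x0 < (n b)%:R + 2^-1]%R `&`
                 [set f | (n b)%:R - 2^-1 < ev f x0]%R `&`
                 [set f | jumps (ev f) b]).
have evc x : continuous (fun f : Cp X R => ev f x : R).
  exact: (@Cp_eval_continuous X R x).
split=> [b|f].
  split.
    apply: openI.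
      apply: openI.
        exact: open_lt_continuous (evc x0) (@cst_continuous _ _ _).
      exact: open_lt_continuous (@cst_continuous _ _ _) (evc x0).
    have [/successor_ex[s bs smin]|noy] := pselect (exists y, b < y).
      have -> : [set f | jumps (ev f) b] = [set f | 2^-1 + ev f b < ev f s]%R.
        apply/seteqP; split=> f /=; first by move=> /(_ s bs smin); lra.
        move=> jf t bt tmin; have -> : t = s.
          by apply/eqP; rewrite eq_le tmin //= smin.
        by lra.
      apply: open_lt_continuous (evc s) => f.
      exact: (cvg_comp _ _ (evc b f) (cvgD (cvg_cst _) cvg_id)).
    suff -> : [set f | jumps (ev f) b] = setT by exact: openT.
    by apply/seteqP; split=> // f _ s bs; case: noy; exists s.

  (* The witness steps from n(b) to n(b) + 1 right after b; at x0 <= b it takes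
     the value n(b). *)
  pose g : continuousType X R :=
    mkcts (@step_continuous b (n b)%:R%R (n b).+1%:R%R).
  have gE y : ev g y = if y <= b then (n b)%:R%R else (n b).+1%:R%R by [].
  exists g; split=> [|t bt _].
    rewrite /setI /mkset !gE x0min //; split; lra.
  by rewrite !gE lexx leNgt bt /= -(@natr1 _ (n b)); lra.
have [[b0 [[b01 b02] _]]|/nonemptyPn noV] := pselect ([set b |
    ((ev f x0 < (n b)%:R + 2^-1)%R /\ ((n b)%:R - 2^-1 < ev f x0)%R)
    /\ jumps (ev f) b] !=set0); last first.
  apply: sub_finite_set (finite_set0 _) => b Vb.
  by rewrite -noV.
have fin : finite_set (jumps (ev f) `&` n @^-1` [set n b0]).
  apply: nP => c; apply: finite_jumps => x.
  exact: (@cts_fun _ _ (f : continuousType X R)).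
apply: sub_finite_set fin => b [[b1 b2] jb]; split; first exact: jb.
have {}b1 : (ev f x0 < (n b)%:R + 2^-1)%R := b1.
have {}b2 : ((n b)%:R - 2^-1 < ev f x0)%R := b2.
suff : n b == n b0 by move/eqP.
rewrite eqn_leq -[(n b <= _)%N]ltnS -[(n b0 <= _)%N]ltnS -!(ltr_nat R)
   -(@natr1 _ (n b0)) -(@natr1 _ (n b)).
move: (ev f x0) (n b)%:R%R (n b0)%:R%R b01 b02 b1 b2 => r p q b01 b02 b1 b2.
by apply/andP; split; lra.
Qed.

End well_ordered_space.

(** * Calibers of the function space of a well-ordered space *)

(** Let h embed cf(L) into X, and let xi send k in L to an index of cf(L) whose
    value under a fixed cofinal map is at least k. For the family V (h (xi k)),
    point-finiteness makes xi take finitely many values on any set J of indices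
    with a common point, so J is bounded. *)
Lemma caliber_Cp_lt_cofinality (d dL : Order.disp_t)
    (X : orderTopologicalType d) (R : realType) (L : orderType dL) :
  well_ordered X -> infinite_cardinal L -> infinite_set [set: X] ->
  caliber L (Cp X R) -> card_lt [set: X] (cofinality L).
Proof.
move=> wo L_card Xinf calL; apply: contrapT => XNC.
have [woL Linf Llt] := L_card.
have [x1 _] := infinite_setN0 Xinf.
have CX : cofinality L #<= [set: X].
  have [//|[c Cc Xc]] := lt_compare (cofinality L) [set: X] woL.
  have XC : [set: X] #<= cofinality L.
    by apply: card_le_trans Xc _; exact: subset_card_le.
  apply: contrapT => CNX; apply: XNC; split=> //.
  by apply/negP; rewrite card_eq_le XC => /CNX.
have [h _ hinj] := card_leE x1 CX.
have [_ [f fcof]] := cofinality_attained woL.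
have /choice[xi xiP] k : exists z, cofinality L z /\ k <= f z.
  by have [_ [z Cz <-] kz] := fcof k; exists z.
have [V [Vo Vfin]] := @point_finite_family _ X R wo (infinite_setN0 Xinf).
have [J [JL [g gJ]]] := (caliberE L _).1 calL (V \o h \o xi) (fun i => Vo _).
have xifin : finite_set (xi @` J).
  have hfin : finite_set (h @` (xi @` J)).
    by apply: sub_finite_set (Vfin g) => _ [_ [k Jk <-] <-]; exact: gJ.
  apply: card_le_finite hfin; have /card_esym : h @` (xi @` J) #= xi @` J.
    apply: inj_card_eq => _ _ /set_mem [k _ <-] /set_mem [l _ <-].
    by apply: hinj; apply: mem_set; exact: (xiP _).1.
  by rewrite card_eq_le => /andP[].
have [l0 _] := infinite_setN0 Linf.
have [m mJ] : exists m, forall k, J k -> k <= m.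
  have : finite_set (f @` (xi @` J)) by exact: finite_image.
  move=> /finite_seqP[s fs]; exists (\big[Order.max/l0]_(l <- s) l) => k Jk.
  apply: le_trans (xiP k).2 _; apply: le_bigmax_seq => //.
  have : (f @` (xi @` J)) (f (xi k)) by exists (xi k) => //; exists k.
  by rewrite fs.
have Lm : [set: L] #<= [set x | x < m] `|` [set m].
  have LJ : [set: L] #<= J by move: JL; rewrite card_eq_le => /andP[].
  apply: card_le_trans LJ _; apply: subset_card_le => k /mJ.
  by rewrite le_eqVlt => /orP[/eqP ->|]; [right|left].
apply: (card_ltNge (Llt m)); apply: (card_le_trans Lm).
apply: infinite_card_setU1 => mfin; apply: Linf; apply: card_le_finite Lm _.
by rewrite finite_setU; split=> //; exact: finite_set1.
Qed.

Lemma well_ordered_sub (d : Order.disp_t) (W : orderType d) (A : set W) :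
  well_ordered W -> well_ordered (order_topology (sub_type A)).
Proof.
move=> wo; apply: antisymmetric_well_order; first exact: le_anti.
move=> P [x Px]; have [|_ [m Pm <-] mmin] := wo_min (P := val @` [set` P]) wo.
  by exists (val x), x.
by exists m; split=> // y Py; apply: (mmin (val y)); exists y.
Qed.

(** The intervals of the theorem enter only through this statement about an
    arbitrary infinite set A, seen as a well-order in its own right. *)
Lemma caliber_Cp_ord_interval (R : realType) (d : Order.disp_t)
    (W : orderType d) (A : set W) (dL : Order.disp_t) (L : orderType dL) :
  well_ordered W -> infinite_set A -> infinite_cardinal L ->
  caliber L (Cp (ord_interval A) R) <-> card_lt A (cofinality L).
Proof.
move=> wo Ainf L_card.
have AX : A #<= [set: sub_type A].
  by move: (card_setT_sym A); rewrite card_eq_le => /andP[].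
have XA : [set: sub_type A] #<= A.
  by move: (card_setT A); rewrite card_eq_le => /andP[].
have Xinf : infinite_set [set: sub_type A] by move=> /(card_le_finite AX).
split=> [cal|/(card_le_lt_trans XA) lt]; last exact: lt_cofinality_caliber_Cp.
apply: (card_le_lt_trans AX).
exact: (caliber_Cp_lt_cofinality (X := order_topology (sub_type A))
  (well_ordered_sub wo) L_card Xinf cal).
Qed.

(** * The two ordinal intervals *)

Theorem proposition5p3 (R : realType)
  (d : Order.disp_t) (W : orderType d) (W_wo : well_ordered W)
  (alpha : W) (alpha_inf : infinite_set [set x : W | x < alpha])
  (dL : Order.disp_t) (L : orderType dL) (L_card : infinite_cardinal L) :
  (caliber L (Cp (ord_interval [set x : W | x <= alpha]) R) <->
     card_lt [set x : W | x < alpha] (cofinality L)) /\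
  (caliber L (Cp (ord_interval [set x : W | x < alpha]) R) <->
     card_lt [set x : W | x < alpha] (cofinality L)).
Proof.
have lt_le : [set x : W | x < alpha] #<= [set x : W | x <= alpha].
  by apply: subset_card_le => x /ltW.
have le_lt : [set x : W | x <= alpha] #<= [set x : W | x < alpha].
  apply: card_le_trans (infinite_card_setU1 alpha alpha_inf).
  apply: subset_card_le => x /=.
  by rewrite le_eqVlt => /orP[/eqP ->|]; [right|left].
split; last exact: caliber_Cp_ord_interval.
apply: iff_trans (caliber_Cp_ord_interval R W_wo _ L_card) _.
  by move=> /(card_le_finite lt_le).
by split; exact: card_le_lt_trans.
Qed.
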